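(* Let $\Gamma$ be a metrized graph with vertex set $V(\Gamma)$ and edge set $E(\Gamma)$, with voltage function $j_z(x,y)$, resistance function $r(x,y)$, canonical measure $\mu_{can}$, tau constant $\tau(\Gamma)$ and Arakelov-Green function $g_{\mu_{can}}(x,y)$. Suppose $e_i \in E(\Gamma)$ is an edge of length $L_i$ with end points $p_i$ and $q_i$, and $e_j \in E(\Gamma)$ is an edge of length $L_j$ with end points $p_j$ and $q_j$. Assume that the edges $e_i$ and $e_j$ are not bridges and are distinct, but their end points are not necessarily distinct. If $x$ belongs to the edge $e_i$ and $y$ belongs to the edge $e_j$, then $$\begin{aligned} g_{\mu_{can}}(x,y) &= \tau(\Gamma) +x^2\, \frac{L_i - r(p_i,q_i)}{2L_i^2}+y^2\, \frac{L_j - r(p_j,q_j)}{2L_j^2} -\frac{xy}{L_i L_j} \big(j_{p_j}(p_i,q_j)-j_{p_j}(q_i,q_j)\big)\\ & \qquad -\frac{x}{2L_i} \big(L_i-2j_{p_i}(q_i,p_j)\big) -\frac{y}{2L_j} \big(L_j-2j_{p_j}(p_i,q_j)\big) -\frac{1}{2}r(p_i,p_j). \end{aligned}$$ If both $x$ and $y$ belong to the same edge $e_i$ of length $L_i$ with end points $p_i$ and $q_i$, then $$g_{\mu_{can}}(x,y) = \tau(\Gamma) - \frac{1}{2}|x-y|+(x-y)^2\, \frac{L_i - r(p_i,q_i)}{2L_i^2}.$$ On the right-hand sides, $x$ and $y$ denote the real parameters (in $[0,L_i]$ or $[0,L_j]$) of the corresponding points.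
   Context: A metrized graph $\Gamma$ is a finite connected graph whose edges are equipped with a distinguished parametrization by line segments (multiple edges and self-loops are allowed). The valence of $p\in\Gamma$ is the number of directions emanating from $p$. A vertex set $V(\Gamma)$ is a finite non-empty subset of $\Gamma$ containing every point of valence $\neq 2$ (additional points of valence 2 may be included). The set $E(\Gamma)$ of edges is the set of closed line segments with end points in $V(\Gamma)$ into which $V(\Gamma)$ divides $\Gamma$; the length of $e_i$ is a positive real number $L_i$. An edge $e_i$ is a bridge if $\Gamma-e_i$, the graph obtained by deleting the interior of $e_i$, is disconnected. Parametrization convention: an edge $e_i$ of length $L_i$ with end points $p_i,q_i$ is identified with $[0,L_i]$ so that $p_i$ corresponds to $0$ and $q_i$ to $L_i$ (likewise for $e_j$). A point of an edge and the corresponding real number are denoted by the same letter: in the arguments of $r$, $j$ and $g_{\mu_{can}}$ the letters denote points of $\Gamma$, elsewhere in formulas they denote the real parameters. Voltage and resistance functions: view $\Gamma$ as a resistive electric circuit in which each edge has resistance equal to its length. For $x,y,z\in\Gamma$, $j_z(x,y)$ is the voltage difference between $x$ and $z$ when unit current enters at $y$ and exits at $z$ (with reference voltage $0$ at $z$). Equivalently, for fixed $y,z$, $x\mapsto j_z(x,y)$ is the unique continuous piecewise affine function $f$ on $\Gamma$ with $f(z)=0$ and $\Delta f=\delta_y-\delta_z$, where $\Delta f=-\sum_{p}\sigma_p(f)\,\delta_p$ and $\sigma_p(f)$ is the sum of the slopes of $f$ in all directions emanating from $p$. The resistance function is $r(x,y)=j_y(x,x)$, the effective resistance between $x$ and $y$.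 Canonical measure, tau constant, Arakelov-Green function: for a real-valued signed Borel measure $\mu$ on $\Gamma$ with $\mu(\Gamma)=1$ and $|\mu|(\Gamma)<\infty$, put $j_\mu(x,y)=\int_\Gamma j_z(x,y)\,d\mu(z)$. There is a unique such measure $\mu=\mu_{can}$ for which $j_\mu(x,x)$ is constant on $\Gamma$; it is called the canonical measure. The tau constant is $\tau(\Gamma)=\frac12 j_{\mu_{can}}(x,x)$ (for any $x\in\Gamma$). The Arakelov-Green function associated to $\mu$ is $$g_\mu(x,y)=\int_\Gamma j_z(x,y)\,d\mu(z)-\int_{\Gamma^3} j_z(x,y)\,d\mu(z)\,d\mu(x)\,d\mu(y).$$ *)

(* Defs.v *)
From HB Require Import structures.
From mathcomp Require Import all_boot all_order all_algebra.
From mathcomp Require Import all_classical all_reals all_analysis.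

Set Implicit Arguments.
Unset Strict Implicit.
Unset Printing Implicit Defensive.

Import Order.TTheory GRing.Theory Num.Theory.
Import numFieldNormedType.Exports.

Local Open Scope classical_set_scope.
Local Open Scope ring_scope.

(* Adjacency and connectedness of the multigraph with vertex type V whose
   edges are those of E selected by P. *)
Definition adjacent (V E : finType) (src tgt : E -> V) (P : pred E) : rel V :=
  fun u v => [exists e in P, ((src e == u) && (tgt e == v))
                          || ((src e == v) && (tgt e == u))].

Definition multigraph_connected (V E : finType) (src tgt : E -> V)
    (P : pred E) : Prop :=
  forall u v : V, connect (adjacent src tgt P) u v.

(* A metrized graph together with a vertex set and a parametrization of each
   edge e by [0, len e], running from src e to tgt e. Self-loops, multiple
   edges and vertices of valence 2 are allowed. *)
Record metrized_graph (R : realType) := MetrizedGraph {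
  vertex : finType ;
  edge : finType ;
  src : edge -> vertex ;
  tgt : edge -> vertex ;
  len : edge -> R ;
  len_gt0 : forall e, 0 < len e ;
  vertex_gt0 : (0 < #|vertex|)%N ;
  graph_connected : multigraph_connected src tgt predT }.

Arguments vertex {R} _.
Arguments edge {R} _.
Arguments src {R m} _.
Arguments tgt {R m} _.
Arguments len {R m} _.

Definition bridge (R : realType) (G : metrized_graph R) (e : edge G) : Prop :=
  ~ multigraph_connected (@src R G) (@tgt R G) (predC1 e).

(* The points of the metrized graph: a vertex, or an edge e together with a
   parameter in the open interval ]0, len e[. *)
Definition gpoint (R : realType) (G : metrized_graph R) : Type :=
  (vertex G + {e : edge G & {t : R | 0 < t < len e}})%type.

Section Space.
Variables (R : realType) (G : metrized_graph R).

HB.instance Definition _ := Choice.on (gpoint G).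
HB.instance Definition _ := isPointed.Build (gpoint G)
  (inl (enum_val (Ordinal (vertex_gt0 G)))).

Definition vpoint (v : vertex G) : gpoint G := inl v.

(* The point of parameter t on e, where t is first clamped to [0, len e]. *)
Definition epoint (e : edge G) (t : R) : gpoint G :=
  if insub t is Some u
  then inr (existT (fun e : edge G => {t : R | 0 < t < len e}) e u)
  else inl (if t <= 0 then src e else tgt e).

(* Quotient topology of the disjoint union of the segments [0, len e] glued at
   the vertices. Clamping is a retraction of R onto [0, len e], so openness in
   [0, len e] may be tested on R. (A connected graph without edges is one
   point.) *)
Definition gopen : set_system (gpoint G) :=
  [set U | forall e : edge G, open (epoint e @^-1` U)].

Let gopenT : gopen setT.
Proof. by move=> e; rewrite preimage_setT; exact: openT. Qed.

Let gopenI : setI_closed gopen.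
Proof. by move=> A B oA oB e; rewrite preimage_setI; exact: openI. Qed.

Let gopen_bigU (I : Type) (f : I -> set (gpoint G)) :
  (forall i, gopen (f i)) -> gopen (\bigcup_i f i).
Proof.
move=> of_ e; rewrite preimage_bigcup.
by apply: bigcup_open => i _; exact: of_.
Qed.

HB.instance Definition _ :=
  isOpenTopological.Build (gpoint G) gopenT gopenI gopen_bigU.

End Space.

Definition borel_gpoint (R : realType) (G : metrized_graph R) :=
  g_sigma_algebraType (@open (gpoint G)).

Section SignedIntegral.
Context {d : measure_display} {T : measurableType d} {R : realType}.
Implicit Types nu : {charge set T -> \bar R}.

Lemma ex_hahn_decomposition nu :
  exists PN : set T * set T, hahn_decomposition nu PN.1 PN.2.
Proof. by have [P [N h]] := Hahn_decomposition nu; exists (P, N). Qed.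

Definition hahn nu :
    hahn_decomposition nu (projT1 (cid (ex_hahn_decomposition nu))).1
                          (projT1 (cid (ex_hahn_decomposition nu))).2 :=
  projT2 (cid (ex_hahn_decomposition nu)).

(* Integral against a real signed measure, by its Jordan decomposition. *)
Definition charge_integral nu (f : T -> R) : R :=
  (\int[jordan_pos (hahn nu)]_x f x - \int[jordan_neg (hahn nu)]_x f x)%R.

Definition total_variation nu : set T -> \bar R := charge_variation (hahn nu).

End SignedIntegral.

Section Potential.
Variables (R : realType) (G : metrized_graph R).
Implicit Types (f : gpoint G -> R) (x y z p : gpoint G).

Definition piecewise_affine f : Prop :=
  forall e : edge G, exists2 s : seq R, itv_partition 0 (len e) s &
    forall k : nat, (k < size s)%N -> exists a b : R,
      forall t : R, nth 0 (0 :: s) k <= t <= nth 0 (0 :: s) k.+1 ->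
        f (epoint e t) = a * t + b.

(* Outgoing slopes at the point of parameter t of e, in the directions of
   increasing and of decreasing parameter. *)
Definition slope_fwd f (e : edge G) (t : R) : R :=
  lim ((f (epoint e (t + h)) - f (epoint e t)) / h @[h --> 0^'+]).

Definition slope_bwd f (e : edge G) (t : R) : R :=
  lim ((f (epoint e (t - h)) - f (epoint e t)) / h @[h --> 0^'+]).

(* A self-loop at v contributes two directions at v. *)
Definition slope_sum f p : R :=
  match p with
  | inl v => \sum_(e : edge G | src e == v) slope_fwd f e 0
           + \sum_(e : edge G | tgt e == v) slope_bwd f e (len e)
  | inr (existT e t) => slope_fwd f e (val t) + slope_bwd f e (val t)
  end.

(* The discrete measure Delta f, given by its mass at each point p. *)
Definition laplacian f p : R := - slope_sum f p.

Definition is_voltage z y f : Prop :=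
  [/\ continuous f, piecewise_affine f, f z = 0 &
      forall p, laplacian f p = (p == y)%:R - (p == z)%:R].

(* voltage z x y is j_z(x, y). *)
Definition voltage z x y : R := get [set f | is_voltage z y f] x.

Definition resistance x y : R := voltage y x x.

Implicit Type mu : {charge set (borel_gpoint G) -> \bar R}.

Definition voltage_mu mu x y : R :=
  charge_integral mu (fun z : borel_gpoint G => voltage z x y).

Definition canonical_measure mu : Prop :=
  [/\ mu setT = 1%:E, (total_variation mu setT < +oo)%E &
      exists c : R, forall x, voltage_mu mu x x = c].

(* The common value over all points x; meaningful for the canonical measure. *)
Definition tau_constant mu : R :=
  get [set t : R | forall x, t = 2^-1 * voltage_mu mu x x].

Definition green mu x y : R :=
  voltage_mu mu x y -
  charge_integral mu (fun b : borel_gpoint G =>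
    charge_integral mu (fun a : borel_gpoint G =>
      charge_integral mu (fun z : borel_gpoint G => voltage z a b))).

End Potential.

Arguments vpoint {R G} v.
Arguments epoint {R G} e t.
Arguments voltage {R G} z x y.
Arguments resistance {R G} x y.

(* Main.v *)
Require Import Defs.
From mathcomp Require Import all_boot all_order all_algebra.
From mathcomp Require Import all_classical all_reals all_analysis.
From mathcomp Require Import measurable_realfun ring lra.

(** Write [j_z(x, y) = g(x, y) - g(x, z) - g(z, y) + g(z, z)] for an explicit
    symmetric kernel [g], so that [2 j_z(x, y) = r(x, z) + r(y, z) - r(x, y)].
    Integrating in [z] against the canonical measure, for which [r(x, _)] has
    integral [2 tau] whatever [x], gives [g_mu = tau - r / 2]; the theorem is
    then the formula for [r] on a pair of edges, read off from [g].

    The kernel is [g(x, y) = sum_(u, v) x_u K(u, v) y_v + tent(x, y)]. Here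
    [x_u] are the barycentric coordinates of [x] with respect to the end points
    of its edge, [K] is the inverse of the weighted graph Laplacian plus the
    all-ones matrix, and [tent(_, y)] is the Green function of the open edge
    containing [y] with zero boundary values. The Laplacian of [g(_, y)] is
    [delta_y] minus the uniform probability on the vertices, so that of
    [g(_, y) - g(_, z)] is [delta_y - delta_z]. *)

Set Implicit Arguments.
Unset Strict Implicit.
Unset Printing Implicit Defensive.

Import Order.TTheory GRing.Theory Num.Theory.
Import numFieldNormedType.Exports.
Local Open Scope classical_set_scope.
Local Open Scope ring_scope.

(** * The discrete kernel on the vertices *)

Section DiscreteKernel.
Context {R : realType} {G : metrized_graph R}.
Local Notation n := #|vertex G|.

Definition incidence (e : edge G) : 'rV[R]_n :=
  \row_k ((src e == enum_val k)%:R - (tgt e == enum_val k)%:R).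

Definition graph_laplacian : 'M[R]_n :=
  \sum_(e : edge G) (len e)^-1 *: ((incidence e)^T *m incidence e).

Definition discrete_kernel (u v : vertex G) : R :=
  invmx (graph_laplacian + const_mx 1) (enum_rank u) (enum_rank v).

Lemma row_incidence (w : 'rV[R]_n) e :
  w *m (incidence e)^T =
  (w 0 (enum_rank (src e)) - w 0 (enum_rank (tgt e)))%:M.
Proof.
apply/rowP => k; rewrite ord1 !mxE mulr1n.
have sumE (v : vertex G) :
    \sum_j w 0 j * (v == enum_val j)%:R = w 0 (enum_rank v).
  rewrite (bigD1 (enum_rank v)) //= enum_rankK eqxx mulr1 big1 ?addr0 // => j jv.
  case: eqP => [vj|]; last by rewrite mulr0.
  by rewrite vj enum_valK eqxx in jv.
rewrite -!sumE -sumrB; apply: eq_bigr => j _.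
by rewrite !mxE mulrBr.
Qed.

Lemma row_graph_laplacian (w : 'rV[R]_n) :
  w *m graph_laplacian = \sum_(e : edge G)
   ((len e)^-1 * (w 0 (enum_rank (src e)) - w 0 (enum_rank (tgt e))))
     *: incidence e.
Proof.
rewrite mulmx_sumr; apply: eq_bigr => e _.
by rewrite -scalemxAr mulmxA row_incidence mul_scalar_mx scalerA.
Qed.

Lemma tr_graph_laplacian : graph_laplacian^T = graph_laplacian.
Proof.
rewrite linear_sum; apply: eq_bigr => e _ /=.
by rewrite linearZ /= trmx_mul trmxK.
Qed.

Lemma tr_const1 : (const_mx 1 : 'M[R]_n)^T = const_mx 1.
Proof. by rewrite trmx_const. Qed.

(** Connectedness of the graph enters here, by induction along a path of adjacent vertices. *)
Lemma constant_of_edges (T : Type) (v : vertex G -> T) :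
  (forall e : edge G, v (src e) = v (tgt e)) -> forall a b, v a = v b.
Proof.
move=> ve a b; have /connectP[p] := graph_connected a b.
elim: p a => [|c p IHp] a /=; first by move=> _ ->.
case/andP => /existsP[e /andP[_ /orP[]/andP[/eqP<- /eqP<-]]] cp bE.
- by rewrite ve; exact: IHp.
- by rewrite -ve; exact: IHp.
Qed.

(** This quadratic form is the Dirichlet energy with conductances [1 / len e]; as a sum of
    nonnegative terms it vanishes only if every edge difference does. *)
Lemma energyE (w : 'rV[R]_n) :
  w *m graph_laplacian *m w^T = (\sum_(e : edge G) (len e)^-1 *
    (w 0 (enum_rank (src e)) - w 0 (enum_rank (tgt e))) ^+ 2)%:M.
Proof.
rewrite row_graph_laplacian mulmx_suml raddf_sum; apply: eq_bigr => e _.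
rewrite -scalemxAl -[incidence e *m _]trmxK trmx_mul trmxK row_incidence.
by rewrite tr_scalar_mx /= scale_scalar_mx -mulrA -expr2.
Qed.

Lemma energy_term_ge0 (w : 'rV[R]_n) e : 0 <= (len e)^-1 *
  (w 0 (enum_rank (src e)) - w 0 (enum_rank (tgt e))) ^+ 2.
Proof. by rewrite mulr_ge0 ?sqr_ge0// invr_ge0 ltW// len_gt0. Qed.

Lemma energy0_constant (w : 'rV[R]_n) :
  w *m graph_laplacian *m w^T = 0 -> forall a b, w 0 a = w 0 b.
Proof.
rewrite energyE => /matrixP/(_ 0 0); rewrite !mxE mulr1n => /eqP.
rewrite psumr_eq0; last by move=> e _; exact: energy_term_ge0.
move=> /allP e0 a b.
have ee (e : edge G) : w 0 (enum_rank (src e)) = w 0 (enum_rank (tgt e)).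
  have /implyP/(_ isT) := e0 e (mem_index_enum _).
  rewrite mulf_eq0 invr_eq0 (gt_eqF (len_gt0 e)) /= sqrf_eq0 subr_eq0.
  by move/eqP.
have := constant_of_edges (v := fun x => w 0 (enum_rank x)) ee
  (enum_val a) (enum_val b).
by rewrite !enum_valK.
Qed.

(** For [w] in the kernel, the energy of [w] plus the square of its coordinate sum [s] is zero, so
    both vanish: the first makes [w] constant, the second makes that constant zero. *)
Lemma graph_laplacian_unit : graph_laplacian + const_mx 1 \in unitmx.
Proof.
rewrite -row_free_unit; apply: inj_row_free => w w0.
set s := \sum_j w 0 j.
have J : w *m const_mx 1 *m w^T = (s ^+ 2)%:M.
  apply/matrixP => i j; rewrite !ord1 !mxE mulr1n expr2 [in RHS]mulr_sumr.
  apply: eq_bigr => k _; rewrite !mxE; congr (_ * _).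
  by apply: eq_bigr => l _; rewrite mxE mulr1.
have : w *m (graph_laplacian + const_mx 1) *m w^T = 0 by rewrite w0 mul0mx.
rewrite mulmxDr mulmxDl J energyE -raddfD => /matrixP/(_ 0 0).
rewrite !mxE mulr1n => /eqP.
rewrite paddr_eq0 ?sqr_ge0//; last first.
  by apply: sumr_ge0 => e _; exact: energy_term_ge0.
case/andP => /eqP L0; rewrite sqrf_eq0 => /eqP s0.
have cst : forall a b, w 0 a = w 0 b.
  by apply: energy0_constant; rewrite energyE L0 raddf0.
apply/rowP => k; rewrite mxE.
have : s = n%:R * w 0 k.
  rewrite /s (eq_bigr (fun=> w 0 k)); last by move=> j _; exact: cst.
  by rewrite sumr_const card_ord mulr_natl.
rewrite s0 => /esym/eqP; rewrite mulf_eq0 pnatr_eq0 => /orP[|/eqP//].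
by rewrite (gtn_eqF (vertex_gt0 G)).
Qed.

Lemma discrete_kernelC u v : discrete_kernel u v = discrete_kernel v u.
Proof.
rewrite /discrete_kernel -[in LHS](trmxK (invmx _)) mxE trmx_inv.
by rewrite linearD /= tr_graph_laplacian tr_const1.
Qed.

Lemma sum_incidence (u : vertex G) (c : edge G -> R) :
  (\sum_e c e *: incidence e) 0 (enum_rank u) =
  \sum_e c e * ((src e == u)%:R - (tgt e == u)%:R).
Proof.
by rewrite summxE; apply: eq_bigr => e _; rewrite !mxE enum_rankK.
Qed.

(** Row [v] of [K] times [Q] is the indicator of [v]. The Laplacian part of [Q] gives the sum over
    edges, the all-ones part the row sum of [K], which is [1 / n] because the all-ones vector is an
    eigenvector of [Q] with eigenvalue [n]. *)
Lemma laplacian_discrete_kernel u v :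
  \sum_(e : edge G) (len e)^-1 *
    (discrete_kernel (src e) v - discrete_kernel (tgt e) v) *
    ((src e == u)%:R - (tgt e == u)%:R) = (u == v)%:R - n%:R^-1.
Proof.
set Q := graph_laplacian + const_mx 1; set K := invmx Q.
have n0 : n%:R != 0 :> R by rewrite pnatr_eq0 -lt0n vertex_gt0.
pose one : 'rV[R]_n := const_mx 1.
have oneQ : one *m Q = n%:R *: one.
  rewrite mulmxDr row_graph_laplacian big1 ?add0r; last first.
    by move=> e _; rewrite !mxE subrr mulr0 scale0r.
  apply/rowP => k; rewrite !mxE mulr1.
  rewrite (eq_bigr (fun=> 1)); last by move=> j _; rewrite !mxE mulr1.
  by rewrite sumr_const card_ord.
have oneK : one *m K = n%:R^-1 *: one.
  apply: (can_inj (scalerK n0)); rewrite scalerA divff// scale1r scalemxAl.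
  by rewrite -oneQ -mulmxA mulmxV ?graph_laplacian_unit// mulmx1.
pose w := row (enum_rank v) K.
have : w *m Q = row (enum_rank v) 1%:M.
  by rewrite -row_mul mulVmx// graph_laplacian_unit.
rewrite mulmxDr row_graph_laplacian => /rowP/(_ (enum_rank u)).
rewrite mxE sum_incidence [X in _ + X]mxE.
(* [oneK] gives the column sums of [K]; symmetry turns them into row sums. *)
have -> : \sum_j w 0 j * (const_mx 1 : 'M[R]_n) j (enum_rank u) = n%:R^-1.
  have trK : K^T = K by rewrite trmx_inv linearD /= tr_graph_laplacian tr_const1.
  have := congr1 (fun M : 'rV[R]_n => M 0 (enum_rank v)) oneK.
  rewrite !mxE mulr1 => <-; apply: eq_bigr => j _.
  by rewrite !mxE mulr1 mul1r -[in LHS]trK mxE.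
rewrite !mxE (inj_eq enum_rank_inj) eq_sym => <-; rewrite addrK.
apply: eq_bigr => e _; congr (_ * _ * _).
by rewrite (discrete_kernelC (src e)) (discrete_kernelC (tgt e)) !mxE.
Qed.

Lemma discrete_harmonic_constant (v : vertex G -> R) :
  (forall u, \sum_(e : edge G) (len e)^-1 * (v (src e) - v (tgt e)) *
    ((src e == u)%:R - (tgt e == u)%:R) = 0) -> forall a b, v a = v b.
Proof.
move=> v0 a b; pose w : 'rV[R]_n := \row_k v (enum_val k).
have wE x : w 0 (enum_rank x) = v x by rewrite mxE enum_rankK.
rewrite -!wE; apply: energy0_constant.
suff -> : w *m graph_laplacian = 0 by rewrite mul0mx.
apply/rowP => k; rewrite -(enum_valK k) row_graph_laplacian sum_incidence mxE.
by rewrite -[RHS](v0 (enum_val k)); apply: eq_bigr => e _; rewrite !wE.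
Qed.

End DiscreteKernel.

(** * Real induction *)

Section RealInduction.
Context {R : realType}.

Lemma near_at_right0P (P : R -> Prop) :
  (\forall h \near 0^'+, P h) <->
  exists2 eps : R, 0 < eps & forall h, 0 < h < eps -> P h.
Proof.
split=> [|[eps eps0 epsP]].
- rewrite near_withinE => /nbhs_ballP[eps /= eps0 epsP]; exists eps => // h.
  case/andP=> h0 heps; apply: epsP => //.
  by rewrite /ball /= sub0r normrN gtr0_norm.
- rewrite near_withinE; apply/nbhs_ballP; exists eps => //= h.
  rewrite /ball /= sub0r normrN => heps h0; apply: epsP.
  by rewrite h0 -(gtr0_norm h0).
Qed.

(** The supremum [sup S] satisfies [P] by the left-hand hypothesis, and the right-hand one would
    push it further if it were below [l]. This turns one-sided local data into statements on a whole
    segment. *)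
Lemma real_induction (l : R) (P : R -> Prop) :
  P 0 ->
  (forall t, 0 <= t < l -> (forall u, 0 <= u <= t -> P u) ->
    \forall h \near 0^'+, P (t + h)) ->
  (forall t, 0 < t <= l -> (forall u, 0 <= u < t -> P u) -> P t) ->
  forall t, 0 <= t <= l -> P t.
Proof.
move=> P0 Pr Pl t tl.
have l0 : 0 <= l by lra.
pose S := [set t | 0 <= t <= l /\ forall u, 0 <= u <= t -> P u].
have S0 : S 0.
  split=> [|u u0]; first by rewrite lexx.
  by have -> : u = 0 by lra.
have hS : has_sup S by split; [exists 0|exists l => u [/andP[]]].
have s0 : 0 <= sup S by apply: ub_le_sup => //; exact: hS.2.
have sl : sup S <= l by apply: ge_sup; [exists 0|move=> u [/andP[]]].
have Ps u : 0 <= u < sup S -> P u.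
  case/andP => u0; rewrite -subr_gt0 => us.
  by have [w [_ Pw] uw] := sup_adherent us hS; apply: Pw; lra.
have Pss u : 0 <= u <= sup S -> P u.
  rewrite [u <= _]le_eqVlt => /andP[u0 /orP[/eqP us|us]]; last first.
    by apply: Ps; rewrite u0.
  have [->//|u1] := eqVneq u 0.
  by apply: Pl => [|w]; [rewrite lt_neqAle eq_sym u1 u0 us|rewrite us; exact: Ps].
suff ls : l <= sup S by apply: Pss; lra.
rewrite leNgt; apply/negP => sltl.
have /near_at_right0P[eps eps0 epsP] : \forall h \near 0^'+, P (sup S + h).
  by apply: Pr => //; rewrite s0.
(* Halving [eps] keeps [sup S + d] strictly inside the range of [epsP]; the other bound keeps it in
   [[0, l]]. *)
pose d := Num.min (eps / 2) (l - sup S).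
have d0 : 0 < d by rewrite lt_min; lra.
have : S (sup S + d).
  have dl : d <= l - sup S by rewrite ge_min lexx orbT.
  have de : d <= eps / 2 by rewrite ge_min lexx.
  split=> [|u ud]; first by lra.
  have [us|us] := leP u (sup S); first by apply: Pss; lra.
  by rewrite -(subrK (sup S) u) addrC; apply: epsP; lra.
move/(ub_le_sup hS.2); lra.
Qed.

End RealInduction.

(** * Germs of piecewise affine functions *)

Section Germs.
Context {R : realType}.
Implicit Types (g k : R -> R) (t m l : R).

(** Both slopes are outgoing: a function affine around [t] with slope [a] has forward germ [a] and
    backward germ [- a]. *)
Definition germ_fwd g t m := \forall h \near 0^'+, g (t + h) = g t + m * h.
Definition germ_bwd g t m := \forall h \near 0^'+, g (t - h) = g t + m * h.

(** A form of piecewise affinity without a partition, so that subtracting two such functions needs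
    no common subdivision. *)
Definition has_germs l g :=
  (forall t, 0 <= t < l -> exists m, germ_fwd g t m) /\
  (forall t, 0 < t <= l -> exists m, germ_bwd g t m).

Definition affine_on_pieces g (s : seq R) :=
  forall i, (i < size s)%N -> exists a b : R,
    forall t, nth 0 (0 :: s) i <= t <= nth 0 (0 :: s) i.+1 -> g t = a * t + b.

Lemma lim_near_quotient (d : R -> R) m :
  (\forall h \near 0^'+, d h = m * h) -> lim (d h / h @[h --> 0^'+]) = m.
Proof.
move=> dm; apply: lim_near_cst => //.
near=> h; rewrite (near dm h)// mulfK//.
Unshelve. all: by end_near. Qed.

Lemma lim_germ_fwd g t m : germ_fwd g t m ->
  lim ((g (t + h) - g t) / h @[h --> 0^'+]) = m.
Proof.
move=> gm; apply: (lim_near_quotient (d := fun h => g (t + h) - g t)).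
by apply: filterS gm => h ->; rewrite addrAC subrr add0r.
Qed.

Lemma lim_germ_bwd g t m : germ_bwd g t m ->
  lim ((g (t - h) - g t) / h @[h --> 0^'+]) = m.
Proof.
move=> gm; apply: (lim_near_quotient (d := fun h => g (t - h) - g t)).
by apply: filterS gm => h ->; rewrite addrAC subrr add0r.
Qed.

Lemma germ_fwdB g k t m m' : germ_fwd g t m -> germ_fwd k t m' ->
  germ_fwd (fun u => g u - k u) t (m - m').
Proof. by apply: filterS2 => h -> ->; ring. Qed.

Lemma germ_bwdB g k t m m' : germ_bwd g t m -> germ_bwd k t m' ->
  germ_bwd (fun u => g u - k u) t (m - m').
Proof. by apply: filterS2 => h -> ->; ring. Qed.

Lemma germ_fwd_cst c t : germ_fwd (fun=> c) t 0.
Proof. by apply: nearW => h; rewrite mul0r addr0. Qed.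

Lemma germ_bwd_cst c t : germ_bwd (fun=> c) t 0.
Proof. by apply: nearW => h; rewrite mul0r addr0. Qed.

Lemma has_germsB l g k : has_germs l g -> has_germs l k ->
  has_germs l (fun u => g u - k u).
Proof.
move=> [gf gb] [kf kb]; split=> t tl.
- have [[m gm] [m' km]] := (gf _ tl, kf _ tl).
  by exists (m - m'); exact: germ_fwdB.
- have [[m gm] [m' km]] := (gb _ tl, kb _ tl).
  by exists (m - m'); exact: germ_bwdB.
Qed.

Lemma path_itv_fwd (a : R) s t : path <%R a s -> a <= t < last a s ->
  exists2 i, (i < size s)%N & nth 0 (a :: s) i <= t < nth 0 (a :: s) i.+1.
Proof.
elim: s a => [|b s IHs] a /=; first by move=> _; lra.
case/andP => ab bs /andP[at_ tl]; have [tb|bt] := ltP t b.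
  by exists 0%N; rewrite //= at_.
have [i ils ti] : exists2 i, (i < size s)%N &
    nth 0 (b :: s) i <= t < nth 0 (b :: s) i.+1 by apply: IHs; rewrite ?bt.
by exists i.+1.
Qed.

Lemma path_itv_bwd (a : R) s t : path <%R a s -> a < t <= last a s ->
  exists2 i, (i < size s)%N & nth 0 (a :: s) i < t <= nth 0 (a :: s) i.+1.
Proof.
elim: s a => [|b s IHs] a /=; first by move=> _; lra.
case/andP => ab bs /andP[at_ tl]; have [tb|bt] := leP t b.
  by exists 0%N; rewrite //= at_.
have [i ils ti] : exists2 i, (i < size s)%N &
    nth 0 (b :: s) i < t <= nth 0 (b :: s) i.+1 by apply: IHs; rewrite ?bt.
by exists i.+1.
Qed.

Lemma has_germs_pieces l g s : itv_partition 0 l s -> affine_on_pieces g s ->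
  has_germs l g.
Proof.
case=> ps /eqP <- gs; split=> t tl.
- have [i il /andP[ti it]] := path_itv_fwd ps tl.
  have [a [b gab]] := gs _ il; exists a.
  apply/near_at_right0P; exists (nth 0 (0 :: s) i.+1 - t); first lra.
  by move=> h h0; rewrite !gab; [ring|lra|lra].
- have [i il /andP[ti it]] := path_itv_bwd ps tl.
  have [a [b gab]] := gs _ il; exists (- a).
  apply/near_at_right0P; exists (t - nth 0 (0 :: s) i); first lra.
  by move=> h h0; rewrite !gab; [ring|lra|lra].
Qed.

Lemma affine_on_pieces_rcons g t u s a b : itv_partition 0 t s -> t < u ->
  affine_on_pieces g s -> (forall w, t <= w <= u -> g w = a * w + b) ->
  exists2 s', itv_partition 0 u s' & affine_on_pieces g s'.
Proof.
case=> ps /eqP ls tu gs gtu; exists (rcons s u).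
  by split; rewrite ?last_rcons ?eqxx// rcons_path ps ls.
move=> i; rewrite size_rcons ltnS leq_eqVlt => /orP[/eqP->|il].
  exists a, b => w; rewrite -rcons_cons !nth_rcons /= ltnSn ltnn eqxx.
  by have := nth_last 0 (0 :: s); rewrite /= ls => ->; exact: gtu.
have [a' [b' gab]] := gs _ il; exists a', b' => w.
by rewrite -rcons_cons !nth_rcons /= !ltnS (ltnW il) il; exact: gab.
Qed.

(** Real induction on the end of the partition: a forward germ prolongs a partition beyond [t], a
    backward germ completes at [t] a partition ending slightly before it. *)
Lemma pieces_has_germs l g : 0 <= l -> has_germs l g ->
  exists2 s, itv_partition 0 l s & affine_on_pieces g s.
Proof.
move=> l0 [gf gb].
apply: (real_induction (l := l)
  (P := fun t => exists2 s, itv_partition 0 t s & affine_on_pieces g s)).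
- by exists [::] => //; split.
- move=> t tl Pt; have [s ps gs] := Pt t ltac:(lra).
  have [m /near_at_right0P[eps eps0 epsm]] := gf t tl.
  apply/near_at_right0P; exists eps => // h h0.
  apply: (affine_on_pieces_rcons (a := m) (b := g t - m * t) ps) => //; first lra.
  move=> w wt; have [->|wt'] := eqVneq w t; first ring.
  have tw : t < w by rewrite lt_neqAle eq_sym wt'; lra.
  by rewrite -{1}(subrK t w) [_ + t]addrC epsm; [ring|lra].
- move=> t tl Pt; have [m /near_at_right0P[eps eps0 epsm]] := gb t tl.
  pose d := Num.min (eps / 2) t.
  have d0 : 0 < d by rewrite lt_min; lra.
  have dl : d <= t by rewrite ge_min lexx orbT.
  have de : d <= eps / 2 by rewrite ge_min lexx.
  have [s ps gs] := Pt (t - d) ltac:(lra).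
  apply: (affine_on_pieces_rcons (a := - m) (b := g t + m * t) ps) => //; first lra.
  move=> w wt; have [->|wt'] := eqVneq w t; first ring.
  have tw : w < t by rewrite lt_neqAle wt'; lra.
  have -> : w = t - (t - w) by ring.
  by rewrite epsm; [ring|lra].
- by rewrite l0 lexx.
Qed.

(** Opposite slopes mean no kink in the interior, so the affine law spreads along the segment by
    real induction. *)
Lemma affine_of_opposite_germs l g m : has_germs l g -> germ_fwd g 0 m ->
  (forall t m1 m2, 0 < t < l -> germ_fwd g t m1 -> germ_bwd g t m2 ->
    m1 + m2 = 0) ->
  forall t, 0 <= t <= l -> g t = g 0 + m * t.
Proof.
move=> [gf gb] gm gopp; apply: real_induction.
- by rewrite mulr0 addr0.
- move=> t tl Pt; have [->|t0] := eqVneq t 0.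
    by apply: filterS gm => h; rewrite add0r.
  have t1 : 0 < t by rewrite lt_neqAle eq_sym t0; case/andP: tl.
  have [m1 gm1] := gf _ tl.
  have gm2 : germ_bwd g t (- m).
    apply/near_at_right0P; exists t => // h ht.
    by rewrite (Pt (t - h)) ?(Pt t); [ring|lra|lra].
  have /eqP := gopp t _ _ ltac:(lra) gm1 gm2; rewrite subr_eq0 => /eqP m1m.
  by apply: filterS gm1 => h ->; rewrite (Pt t) ?m1m; [ring|lra].
- move=> t tl Pt; have [m2 /near_at_right0P[eps eps0 epsm]] := gb _ tl.
  pose d := Num.min (eps / 2) (t / 2).
  have d0 : 0 < d by rewrite lt_min; lra.
  have dl : d <= t / 2 by rewrite ge_min lexx orbT.
  have de : d <= eps / 2 by rewrite ge_min lexx.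
  (* The slope [m2] is unknown; the values of [g] at distances [d] and [d / 2] before [t], known by
     induction, eliminate it and determine [g t]. *)
  have := epsm d ltac:(lra); rewrite (Pt (t - d)); last lra.
  have := epsm (d / 2) ltac:(lra); rewrite (Pt (t - d / 2)); last lra.
  lra.
Qed.

End Germs.

(** * The kernel on the metrized graph *)

Section Points.
Context {R : realType} {G : metrized_graph R}.
Implicit Types (p q x y z : gpoint G) (e : edge G) (u v : vertex G) (t : R).

Definition barycentric p v : R :=
  match p with
  | inl u => (u == v)%:R
  | inr (existT e t) => (1 - sval t / len e) * (src e == v)%:R
                        + sval t / len e * (tgt e == v)%:R
  end.

(** The function [min(s, t) - s t / L] is the Dirichlet Green function of [[0, L]]. It takes a real
    [t] rather than a point so that it can be studied along the edge, ends included. *)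
Definition edge_tent y e t : R :=
  if y is inr (existT e' s)
  then if e' == e then Num.min (sval s) t - sval s * t / len e else 0 else 0.

Definition tent x y : R :=
  if x is inr (existT e t) then edge_tent y e (sval t) else 0.

Definition point_kernel y u : R :=
  \sum_v discrete_kernel u v * barycentric y v.

Definition green_kernel x y : R :=
  \sum_u barycentric x u * point_kernel y u + tent x y.

Lemma len_neq0 e : len e != 0.
Proof. by rewrite gt_eqF// len_gt0. Qed.

Lemma epoint_le0 e t : t <= 0 -> epoint e t = vpoint (src e).
Proof. by move=> t0; rewrite /epoint insubF ?t0// ltNge t0. Qed.

Lemma epoint_ge_len e t : len e <= t -> epoint e t = vpoint (tgt e).
Proof.
move=> tl; have t0 : 0 < t := lt_le_trans (len_gt0 e) tl.
by rewrite /epoint insubF ?[_ <= 0]leNgt ?t0//= ltNge tl.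
Qed.

Lemma epoint_inside e (s : {t : R | 0 < t < len e}) :
  epoint e (sval s) = inr (existT _ e s).
Proof. have -> : sval s = val s by []; by rewrite /epoint valK. Qed.

Lemma gpointP p : (exists u, p = vpoint u) \/
  exists e, exists2 t, 0 < t < len e & p = epoint e t.
Proof.
case: p => [u|[e s]]; first by left; exists u.
by right; exists e, (sval s); rewrite ?epoint_inside ?(svalP s).
Qed.

Lemma eq_inside e e'
    (s : {t : R | 0 < t < len e}) (s' : {t : R | 0 < t < len e'}) :
  (inr (existT _ e s) == inr (existT _ e' s') :> gpoint G) =
  (e == e') && (sval s == sval s').
Proof.
apply/eqP/andP => [[ee]|[/eqP ee]].
  by subst e' => /eqP; rewrite eq_Tagged /= => /eqP->; rewrite !eqxx.
by subst e' => /eqP/val_inj ->.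
Qed.

(** The interpolation formula persists at the ends, where [epoint] collapses to a vertex; later
    computations on closed edges then need no case split. *)
Lemma barycentric_epoint e t v : 0 <= t <= len e ->
  barycentric (epoint e t) v =
    (1 - t / len e) * (src e == v)%:R + t / len e * (tgt e == v)%:R.
Proof.
move=> /andP[t0 tl]; have [t0'|t0'] := leP t 0.
  rewrite epoint_le0//= (_ : t = 0); last by apply/le_anti; rewrite t0 t0'.
  by rewrite mul0r subr0 mul1r mul0r addr0.
have [tl'|tl'] := leP (len e) t.
  rewrite epoint_ge_len//= (_ : t = len e); last by apply/le_anti; rewrite tl tl'.
  by rewrite divff ?len_neq0// subrr mul0r mul1r add0r.
have tle : 0 < t < len e by rewrite t0'.
by rewrite (epoint_inside (exist _ t tle : {t : R | 0 < t < len e})).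
Qed.

Lemma edge_tent0 y e : edge_tent y e 0 = 0.
Proof.
case: y => // -[e' s] /=; case: eqP => // _; rewrite mulr0 mul0r subr0.
by rewrite min_r//; have /andP[/ltW] := svalP s.
Qed.

Lemma edge_tent_len y e : edge_tent y e (len e) = 0.
Proof.
case: y => // -[e' s] /=; case: eqP => // ee; subst e'.
rewrite mulfK ?len_neq0// min_l ?subrr//.
by have /andP[_ /ltW] := svalP s.
Qed.

Lemma tent_epoint e t y : 0 <= t <= len e -> tent (epoint e t) y = edge_tent y e t.
Proof.
move=> /andP[t0 tl]; have [t0'|t0'] := leP t 0.
  rewrite epoint_le0//= (_ : t = 0) ?edge_tent0//.
  by apply/le_anti; rewrite t0 t0'.
have [tl'|tl'] := leP (len e) t.
  rewrite epoint_ge_len//= (_ : t = len e) ?edge_tent_len//.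
  by apply/le_anti; rewrite tl tl'.
have tle : 0 < t < len e by rewrite t0'.
by rewrite (epoint_inside (exist _ t tle : {t : R | 0 < t < len e})).
Qed.

Lemma edge_tent_epoint e t e' s : 0 <= t <= len e -> 0 <= s <= len e' ->
  edge_tent (epoint e' s) e t =
    if e' == e then Num.min s t - s * t / len e else 0.
Proof.
move=> /andP[t0 tl] /andP[s0 sl]; have [s0'|s0'] := leP s 0.
  rewrite epoint_le0//= (_ : s = 0); last by apply/le_anti; rewrite s0 s0'.
  by rewrite min_l// !mul0r subrr if_same.
have [sl'|sl'] := leP (len e') s.
  rewrite epoint_ge_len//= (_ : s = len e'); last by apply/le_anti; rewrite sl sl'.
  case: eqP => // ee; subst e'.
  by rewrite min_r// mulrAC divff ?len_neq0// mul1r subrr.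
have sle : 0 < s < len e' by rewrite s0'.
by rewrite (epoint_inside (exist _ s sle : {t : R | 0 < t < len e'})).
Qed.

Lemma tentC x y : tent x y = tent y x.
Proof.
case: x y => [u|[e t]] [v|[e' s]] //=.
rewrite eq_sym; case: eqP => // ee; subst e'.
by rewrite minC [sval s * _]mulrC.
Qed.

Lemma green_kernelC x y : green_kernel x y = green_kernel y x.
Proof.
rewrite /green_kernel tentC; congr (_ + _).
rewrite /point_kernel.
under eq_bigr do rewrite mulr_sumr.
rewrite exchange_big /=; apply: eq_bigr => v _; rewrite mulr_sumr.
by apply: eq_bigr => u _; rewrite discrete_kernelC; ring.
Qed.

Lemma sum_eq_vertex u (a : vertex G -> R) : \sum_v (u == v)%:R * a v = a u.
Proof.
rewrite (bigD1 u) //= eqxx mul1r big1 ?addr0// => v vu.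
by rewrite eq_sym (negbTE vu) mul0r.
Qed.

Lemma green_kernel_epoint e t y : 0 <= t <= len e ->
  green_kernel (epoint e t) y =
    (1 - t / len e) * point_kernel y (src e) + t / len e * point_kernel y (tgt e)
    + edge_tent y e t.
Proof.
move=> tl; rewrite /green_kernel tent_epoint//; congr (_ + _).
under eq_bigr do rewrite barycentric_epoint// mulrDl -!mulrA.
by rewrite big_split /= -!mulr_sumr !sum_eq_vertex mulrA.
Qed.

Lemma green_kernel_vpoint u y : green_kernel (vpoint u) y = point_kernel y u.
Proof. by rewrite /green_kernel /= addr0 sum_eq_vertex. Qed.

Lemma point_kernel_epoint e t u : 0 <= t <= len e ->
  point_kernel (epoint e t) u =
    (1 - t / len e) * discrete_kernel u (src e)
    + t / len e * discrete_kernel u (tgt e).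
Proof.
move=> tl; rewrite /point_kernel.
under eq_bigr do rewrite barycentric_epoint// mulrC mulrDl -!mulrA.
by rewrite big_split /= -!mulr_sumr !sum_eq_vertex mulrA.
Qed.

Lemma point_kernel_vpoint v u : point_kernel (vpoint v) u = discrete_kernel u v.
Proof.
rewrite /point_kernel; under eq_bigr do rewrite mulrC.
by rewrite sum_eq_vertex.
Qed.

Lemma sum_barycentric p : \sum_v barycentric p v = 1.
Proof.
have sum1 u : \sum_v (u == v)%:R = 1 :> R.
  by rewrite -[RHS](sum_eq_vertex u (fun=> 1)); under [RHS]eq_bigr do rewrite mulr1.
case: p => [u|[e t]] /=; first exact: sum1.
by rewrite big_split /= -!mulr_sumr !sum1; ring.
Qed.

Lemma barycentric_ge0 p v : 0 <= barycentric p v.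
Proof.
case: p => [u|[e t]] /=; first exact: ler0n.
have /andP[t0 tl] := svalP t.
have tl0 : 0 <= sval t / len e by rewrite divr_ge0// ltW// len_gt0.
by rewrite addr_ge0// mulr_ge0// subr_ge0 ler_pdivrMr ?len_gt0// mul1r ltW.
Qed.

Lemma normr_edge_tent_le y e t : 0 < t < len e -> `|edge_tent y e t| <= len e.
Proof.
case/andP => t0 tl; rewrite /edge_tent.
have l0 : 0 <= len e by rewrite ltW// len_gt0.
case: y => [u|[e' s]]; first by rewrite normr0.
case: eqP => [ee|_]; last by rewrite normr0.
subst e'; have /andP[s0 sl] := svalP s.
have st0 : 0 <= sval s * t / len e.
  by rewrite divr_ge0// mulr_ge0// ltW.
have stl : sval s * t / len e <= len e.
  by rewrite ler_pdivrMr ?len_gt0// ler_pM// ltW.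
have m0 : 0 <= Num.min (sval s) t by rewrite le_min !ltW.
have ml : Num.min (sval s) t <= len e by rewrite ge_min ltW.
by rewrite ler_norml; lra.
Qed.

(** * One-sided slopes of the kernel along an edge *)

Definition edge_tent_fwd y e t : R :=
  if y is inr (existT e' s)
  then if e' == e then (t < sval s)%R%:R - sval s / len e else 0 else 0.

(** The weak comparison here and the strict one in [edge_tent_fwd] select the two sides of the peak
    at [t = s], where the outgoing slopes then add up to -1. *)
Definition edge_tent_bwd y e t : R :=
  if y is inr (existT e' s)
  then if e' == e then sval s / len e - (t <= sval s)%R%:R else 0 else 0.

Lemma germ_edge_tent_fwd y e t : germ_fwd (edge_tent y e) t (edge_tent_fwd y e t).
Proof.
rewrite /edge_tent /edge_tent_fwd.
case: y => [u|[e' s]] /=; first exact: germ_fwd_cst.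
case: eqP => _; last exact: germ_fwd_cst.
have [ts|st] := ltP t (sval s) => /=; apply/near_at_right0P.
- exists (sval s - t); first lra.
  by move=> h hs; rewrite !min_r; [ring|lra|lra].
- by exists 1; rewrite // => h hs; rewrite !min_l; [ring|lra|lra].
Qed.

Lemma germ_edge_tent_bwd y e t : germ_bwd (edge_tent y e) t (edge_tent_bwd y e t).
Proof.
rewrite /edge_tent /edge_tent_bwd.
case: y => [u|[e' s]] /=; first exact: germ_bwd_cst.
case: eqP => _; last exact: germ_bwd_cst.
have [ts|st] := leP t (sval s) => /=; apply/near_at_right0P.
- by exists 1; rewrite // => h hs; rewrite !min_r; [ring|lra|lra].
- exists (t - sval s); first lra.
  by move=> h hs; rewrite !min_l; [ring|lra|lra].
Qed.

Lemma germ_green_kernel_fwd y e t : 0 <= t < len e ->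
  germ_fwd (fun w => green_kernel (epoint e w) y) t
    ((len e)^-1 * (point_kernel y (tgt e) - point_kernel y (src e))
     + edge_tent_fwd y e t).
Proof.
move=> tl; have /near_at_right0P[eps eps0 epsP] := germ_edge_tent_fwd y e t.
apply/near_at_right0P; exists (Num.min eps (len e - t)).
  by rewrite lt_min; lra.
move=> h; rewrite lt_min => h0; rewrite !green_kernel_epoint; [|lra|lra].
by rewrite epsP; [ring|lra].
Qed.

Lemma germ_green_kernel_bwd y e t : 0 < t <= len e ->
  germ_bwd (fun w => green_kernel (epoint e w) y) t
    ((len e)^-1 * (point_kernel y (src e) - point_kernel y (tgt e))
     + edge_tent_bwd y e t).
Proof.
move=> tl; have /near_at_right0P[eps eps0 epsP] := germ_edge_tent_bwd y e t.
apply/near_at_right0P; exists (Num.min eps t).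
  by rewrite lt_min; lra.
move=> h; rewrite lt_min => h0; rewrite !green_kernel_epoint; [|lra|lra].
by rewrite epsP; [ring|lra].
Qed.

Lemma edge_tent_slopes y e (s : {t : R | 0 < t < len e}) :
  edge_tent_fwd y e (sval s) + edge_tent_bwd y e (sval s) =
  - (inr (existT _ e s) == y)%:R.
Proof.
case: y => [u|[e' s']]; first by rewrite addr0 oppr0.
rewrite eq_inside eq_sym /=; case: eqP => ee /=; last by rewrite addr0 oppr0.
by case: (ltgtP (sval s) (sval s')) => /= _; lra.
Qed.

Lemma sum_edge_cond (P : pred (edge G)) e0 (a : R) :
  \sum_(e | P e) (if e0 == e then a else 0) = (P e0)%:R * a.
Proof.
rewrite big_mkcond (bigD1 e0) //= eqxx big1 ?addr0.
  by case: (P e0); rewrite ?mul1r ?mul0r.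
by move=> e ee; rewrite eq_sym (negbTE ee) if_same.
Qed.

(** A tent with peak at parameter [s] on an edge of length [L] leaves the source with slope
    [1 - s / L] and the target with slope [s / L], the barycentric coordinates of [y]. If [y] is a
    vertex, both sides are zero. *)
Lemma edge_tent_slopes_vertex y u :
  \sum_(e : edge G | src e == u) edge_tent_fwd y e 0 +
  \sum_(e : edge G | tgt e == u) edge_tent_bwd y e (len e) =
  barycentric y u - (vpoint u == y)%:R.
Proof.
case: y => [v|[e' s]].
  rewrite /= !big1 // addr0; have -> : (vpoint u == inl v :> gpoint G) = (v == u).
    by apply/eqP/eqP => [[->]|->].
  by rewrite subrr.
rewrite /= subr0.
have /andP[s0 sl] := svalP s.
rewrite (eq_bigr (fun e => if e' == e then 1 - sval s / len e' else 0)); last first.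
  by move=> e _; case: eqP => // ee; subst e'; rewrite s0.
rewrite (eq_bigr (F1 := fun e => if e' == e then _ - (len e <= sval s)%R%:R else 0)
   (fun e => if e' == e then sval s / len e' else 0)); last first.
  by move=> e _; case: eqP => // ee; subst e'; rewrite leNgt sl subr0.
by rewrite !sum_edge_cond; ring.
Qed.

End Points.

(** * Voltage and resistance in terms of the kernel *)

Section Voltage.
Context {R : realType} {G : metrized_graph R}.
Implicit Types (f k : gpoint G -> R) (p x y z : gpoint G) (e : edge G).

Definition edge_germs f := forall e, has_germs (len e) (fun t => f (epoint e t)).

Lemma slope_fwdE f e t m :
  germ_fwd (fun w => f (epoint e w)) t m -> slope_fwd f e t = m.
Proof. exact: lim_germ_fwd. Qed.

Lemma slope_bwdE f e t m :
  germ_bwd (fun w => f (epoint e w)) t m -> slope_bwd f e t = m.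
Proof. exact: lim_germ_bwd. Qed.

Lemma slope_fwdP f e t : edge_germs f -> 0 <= t < len e ->
  germ_fwd (fun w => f (epoint e w)) t (slope_fwd f e t).
Proof. by move=> /(_ e)[fg _] /fg[m fm]; rewrite (slope_fwdE fm). Qed.

Lemma slope_bwdP f e t : edge_germs f -> 0 < t <= len e ->
  germ_bwd (fun w => f (epoint e w)) t (slope_bwd f e t).
Proof. by move=> /(_ e)[_ fg] /fg[m fm]; rewrite (slope_bwdE fm). Qed.

Lemma edge_germsB f k : edge_germs f -> edge_germs k ->
  edge_germs (fun x => f x - k x).
Proof. by move=> fg kg e; exact: has_germsB. Qed.

Lemma edge_germs_cst (c : R) : edge_germs (fun=> c).
Proof.
by move=> e; split=> t _; exists 0; [exact: germ_fwd_cst|exact: germ_bwd_cst].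
Qed.

(** * The Laplacian of the kernel, and constancy of harmonic functions *)

Lemma laplacian_cst (c : R) p : laplacian (fun=> c) p = 0.
Proof.
rewrite /laplacian /slope_sum; case: p => [u|[e s]].
- rewrite !big1 ?addr0 ?oppr0// => e _.
    by apply: slope_bwdE; exact: germ_bwd_cst.
  by apply: slope_fwdE; exact: germ_fwd_cst.
- rewrite (slope_fwdE (m := 0)) ?(slope_bwdE (m := 0)) ?addr0 ?oppr0//.
    exact: germ_fwd_cst.
  exact: germ_bwd_cst.
Qed.

(** Slopes are limits, hence subtract only where they converge; germs on every edge ensure this. *)
Lemma laplacianB f k p : edge_germs f -> edge_germs k ->
  laplacian (fun x => f x - k x) p = laplacian f p - laplacian k p.
Proof.
move=> fg kg; have slf e t : 0 <= t < len e ->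
    slope_fwd (fun x => f x - k x) e t = slope_fwd f e t - slope_fwd k e t.
  by move=> tl; apply: slope_fwdE; apply: germ_fwdB; exact: slope_fwdP.
have slb e t : 0 < t <= len e ->
    slope_bwd (fun x => f x - k x) e t = slope_bwd f e t - slope_bwd k e t.
  by move=> tl; apply: slope_bwdE; apply: germ_bwdB; exact: slope_bwdP.
rewrite /laplacian /slope_sum; case: p => [u|[e s]].
- under eq_bigr do rewrite slf ?lexx ?len_gt0//.
  under [X in _ + X]eq_bigr do rewrite slb ?lexx ?len_gt0//.
  by rewrite !sumrB; ring.
- have /andP[s0 sl] := svalP s.
  by rewrite slf ?slb ?s0 ?sl ?ltW//; ring.
Qed.

Lemma edge_germs_green_kernel y : edge_germs (green_kernel^~ y).
Proof.
move=> e; split=> t tl; first by eexists; exact: germ_green_kernel_fwd.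
by eexists; exact: germ_green_kernel_bwd.
Qed.

Definition uniform_mass p : R := if p is inl _ then #|vertex G|%:R^-1 else 0.

(** Inside an edge only the kink of the tent counts. At a vertex [u] the affine parts have slope sum
    [1 / n - barycentric y u] and the tents [barycentric y u - (u == y)], so the barycentric terms
    cancel. *)
Lemma laplacian_green_kernel y p :
  laplacian (green_kernel^~ y) p = (p == y)%:R - uniform_mass p.
Proof.
rewrite /laplacian /slope_sum; case: p => [u|[e s]]; last first.
  have /andP[s0 sl] := svalP s.
  rewrite (slope_fwdE (germ_green_kernel_fwd y _)) ?s0 ?sl ?ltW//.
  rewrite (slope_bwdE (germ_green_kernel_bwd y _)) ?s0 ?sl ?ltW//.
  have /= := edge_tent_slopes y s; lra.
under eq_bigr do rewrite (slope_fwdE (germ_green_kernel_fwd y _)) ?lexx ?len_gt0//.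
under [X in _ + X]eq_bigr do
  rewrite (slope_bwdE (germ_green_kernel_bwd y _)) ?lexx ?len_gt0//.
have tents := edge_tent_slopes_vertex y u.
rewrite !big_split /=.
have lap : \sum_(e : edge G)
    (len e)^-1 * (point_kernel y (src e) - point_kernel y (tgt e)) *
    ((src e == u)%:R - (tgt e == u)%:R) = barycentric y u - #|vertex G|%:R^-1.
  (* [point_kernel y] averages the columns of the discrete kernel with weights [barycentric y]; the
     discrete identity is averaged likewise. *)
  transitivity (\sum_v barycentric y v * ((u == v)%:R - #|vertex G|%:R^-1)).
    under [RHS]eq_bigr do rewrite -laplacian_discrete_kernel mulr_sumr.
    rewrite exchange_big /=; apply: eq_bigr => e _.
    rewrite /point_kernel -sumrB mulr_sumr mulr_suml.
    by apply: eq_bigr => v _; ring.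
  under eq_bigr do rewrite mulrBr mulrC.
  by rewrite sumrB sum_eq_vertex -mulr_suml sum_barycentric mul1r.
(* Regrouping by edges leaving and entering [u]; a self-loop at [u] occurs in both sums and
   cancels. *)
have {}lap : \sum_(e : edge G | src e == u)
      (len e)^-1 * (point_kernel y (tgt e) - point_kernel y (src e)) +
    \sum_(e : edge G | tgt e == u)
      (len e)^-1 * (point_kernel y (src e) - point_kernel y (tgt e)) =
    #|vertex G|%:R^-1 - barycentric y u.
  rewrite -opprB -lap -sumrN !(big_mkcond (fun e => _ == u)) -big_split /=.
  by apply: eq_bigr => e _; do 2 case: eqP => _ /=; ring.
have -> : (inl u == y) = (vpoint u == y) by [].
rewrite /uniform_mass /=; lra.
Qed.

(** Without kinks [f] is affine on each edge; at the vertices the hypothesis then says that the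
    vertex values are discretely harmonic, hence all equal, and [f] has slope zero on every edge. *)
Lemma harmonic_constant f : edge_germs f -> (forall p, laplacian f p = 0) ->
  forall x y, f x = f y.
Proof.
move=> fg f0.
have aff e t : 0 <= t <= len e ->
    f (epoint e t) = f (vpoint (src e)) + slope_fwd f e 0 * t.
  rewrite -(epoint_le0 e (lexx 0)).
  apply: (affine_of_opposite_germs (g := fun w => f (epoint e w)) (fg e)).
    by apply: slope_fwdP; rewrite // lexx len_gt0.
  move=> w m1 m2 wl gm1 gm2.
  have /eqP := f0 (inr (existT _ e (exist _ w wl))).
  rewrite /laplacian oppr_eq0 /= => /eqP.
  by rewrite (slope_fwdE gm1) (slope_bwdE gm2).
have slopeE e : slope_fwd f e 0 =
    (len e)^-1 * (f (vpoint (tgt e)) - f (vpoint (src e))).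
  have := aff e (len e); rewrite epoint_ge_len// lexx ltW ?len_gt0// => ->//.
  by rewrite addrAC subrr add0r mulrCA mulVf ?mulr1// len_neq0.
have bwdE e : slope_bwd f e (len e) =
    (len e)^-1 * (f (vpoint (src e)) - f (vpoint (tgt e))).
  rewrite -opprB mulrN -slopeE; apply: slope_bwdE.
  apply/near_at_right0P; exists (len e); first exact: len_gt0.
  move=> h hl; rewrite aff; last lra.
  by rewrite aff; [ring|rewrite lexx ltW ?len_gt0].
have vconst u v : f (vpoint u) = f (vpoint v).
  move: u v; apply: (discrete_harmonic_constant (v := fun u => f (vpoint u))) => u.
  have /eqP := f0 (vpoint u); rewrite /laplacian oppr_eq0 /= => /eqP slu.
  apply: oppr_inj; rewrite oppr0 -[RHS]slu -sumrN !(big_mkcond (fun e => _ == u)).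
  rewrite -big_split /=.
  by apply: eq_bigr => e _; rewrite slopeE bwdE; do 2 case: eqP => _ /=; ring.
have econst e t : 0 <= t <= len e -> f (epoint e t) = f (vpoint (src e)).
  move=> tl; rewrite aff// slopeE (vconst (tgt e) (src e)).
  by rewrite subrr mulr0 mul0r addr0.
suff cst x u : f x = f (vpoint u).
  by move=> x y; rewrite !(cst _ (enum_val (Ordinal (vertex_gt0 G)))).
have [[v ->]//|[e [t tl ->]]] := gpointP x.
by rewrite econst//; lra.
Qed.

(** * Continuity of the kernel *)

Lemma continuous_gpoint f : (forall e, continuous (fun t : R => f (epoint e t))) ->
  continuous f.
Proof.
move=> fc; apply/continuousP => A oA.
(* Open sets of the graph are by definition those with open preimage under every [epoint e]. *)
suff : gopen (f @^-1` A) by [].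
move=> e.
by have /continuousP/(_ _ oA) := fc e.
Qed.

Lemma continuous_edge_tent y e : continuous (edge_tent y e).
Proof.
rewrite /edge_tent; case: y => [u|[e' s]]; first exact: cst_continuous.
case: eqP => _; last exact: cst_continuous.
move=> t; apply: cvgB.
  by apply: (continuous_min (f := fun=> sval s)); [exact: cvg_cst|exact: cvg_id].
by apply: cvgMl; apply: cvgMr; exact: cvg_id.
Qed.

Definition clamp e (t : R) : R := Num.max 0 (Num.min t (len e)).

Lemma clamp_itv e t : 0 <= clamp e t <= len e.
Proof. by rewrite le_max lexx /= ge_max ge_min lexx orbT ltW ?len_gt0. Qed.

Lemma epoint_clamp e t : epoint e (clamp e t) = epoint e t.
Proof.
rewrite /clamp; have [t0|t0] := leP t 0.
  have tl : t <= len e by rewrite (le_trans t0)// ltW// len_gt0.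
  by rewrite min_l// max_l// !epoint_le0.
have [tl|tl] := leP (len e) t.
  by rewrite max_r ?ltW ?len_gt0// !epoint_ge_len.
by rewrite max_r// ltW.
Qed.

Lemma continuous_clamp e : continuous (clamp e).
Proof.
move=> t; apply: (@continuous_max R R (fun=> 0) (fun w => Num.min w (len e))).
  exact: cvg_cst.
by apply: (@continuous_min R R id (fun=> len e)); [exact: cvg_id|exact: cvg_cst].
Qed.

(** Here [h] is [g] composed with the clamping retraction, so a formula valid only on [[0, len e]]
    yields continuity on the whole line. *)
Lemma continuous_edge (g h : R -> R) e : continuous g ->
  (forall t, 0 <= t <= len e -> h t = g t) ->
  (forall t, h (clamp e t) = h t) -> continuous h.
Proof.
move=> gc hg hc; have -> : h = g \o clamp e.
  by apply/funext => t /=; rewrite -hg ?clamp_itv.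
by move=> t; apply: continuous_comp; [exact: continuous_clamp|exact: gc].
Qed.

Lemma continuous_green_kernel y e :
  continuous (fun t : R => green_kernel (epoint e t) y).
Proof.
apply: (continuous_edge (e := e)) => [|t tl|t]; last by rewrite epoint_clamp.
  2: exact: green_kernel_epoint.
move=> t; apply: cvgD; last exact: continuous_edge_tent.
apply: cvgD; apply: cvgMl; last by apply: cvgMl; exact: cvg_id.
by apply: cvgB; [exact: cvg_cst|apply: cvgMl; exact: cvg_id].
Qed.

(** Continuity in each variable separately would not suffice; on the diagonal the tent becomes the
    polynomial [t - t * t / len e]. *)
Lemma continuous_green_kernel_diag e :
  continuous (fun t : R => green_kernel (epoint e t) (epoint e t)).
Proof.
pose K u t := (1 - t / len e) * discrete_kernel u (src e)
  + t / len e * discrete_kernel u (tgt e).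
apply: (continuous_edge (e := e) (g := fun t => (1 - t / len e) * K (src e) t
    + t / len e * K (tgt e) t + (t - t * t / len e))) => [|t tl|t];
  last by rewrite epoint_clamp.
  2: by rewrite green_kernel_epoint// !point_kernel_epoint// edge_tent_epoint// eqxx
     minxx.
have cs : continuous (fun t : R => t / len e).
  by move=> t; apply: cvgMl; exact: cvg_id.
have cr : continuous (fun t : R => 1 - t / len e).
  by move=> t; apply: cvgB; [exact: cvg_cst|exact: cs].
have cK u : continuous (K u).
  by move=> t; apply: cvgD; apply: cvgMl; [exact: cr|exact: cs].
move=> t; apply: cvgD.
  apply: cvgD; first by apply: cvgM; [exact: cr|exact: cK].
  by apply: cvgM; [exact: cs|exact: cK].
apply: cvgB; first exact: cvg_id.
by apply: cvgMl; apply: cvgM; exact: cvg_id.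
Qed.

(** * Identification of the voltage and resistance functions *)

Lemma piecewise_affine_edge_germs f : piecewise_affine f <-> edge_germs f.
Proof.
split=> fg e; first by have [s ps fs] := fg e; exact: has_germs_pieces ps fs.
by apply: pieces_has_germs; [rewrite ltW ?len_gt0|exact: fg].
Qed.

Lemma is_voltage_green_kernel z y : is_voltage z y
  (fun x => green_kernel x y - green_kernel x z
    - (green_kernel z y - green_kernel z z)).
Proof.
have g1 := edge_germsB (@edge_germs_green_kernel y) (@edge_germs_green_kernel z).
have g2 := @edge_germs_cst (green_kernel z y - green_kernel z z).
split.
- apply: continuous_gpoint => e t; apply: cvgB; last exact: cvg_cst.
  by apply: cvgB; exact: continuous_green_kernel.
- by apply/piecewise_affine_edge_germs; exact: edge_germsB.
- by rewrite subrr.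
- move=> p; rewrite laplacianB// laplacianB ?laplacian_cst//;
    try exact: edge_germs_green_kernel.
  by rewrite !laplacian_green_kernel; ring.
Qed.

(** [voltage] selects some function with the voltage property; its difference from the explicit one
    is harmonic and vanishes at [z], hence is zero. *)
Lemma voltageE z x y :
  voltage z x y = green_kernel x y - green_kernel x z
    - (green_kernel z y - green_kernel z z).
Proof.
have ex : exists f, [set f | is_voltage z y f] f.
  by eexists; exact: is_voltage_green_kernel.
have [_ /piecewise_affine_edge_germs g1 z1 l1] := getPex ex.
have [_ /piecewise_affine_edge_germs g2 z2 l2] := is_voltage_green_kernel z y.
have := harmonic_constant (edge_germsB g1 g2) _ x z.
rewrite z1 z2 subr0 => H; apply/eqP; rewrite -subr_eq0; apply/eqP/H => p.
by rewrite laplacianB// l1 l2 subrr.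
Qed.

Lemma resistanceE x y :
  resistance x y = green_kernel x x - 2 * green_kernel x y + green_kernel y y.
Proof. by rewrite /resistance voltageE (green_kernelC y x); ring. Qed.

Lemma voltage_resistance z x y :
  voltage z x y = 2^-1 * (resistance x z + resistance y z - resistance x y).
Proof. by rewrite voltageE !resistanceE (green_kernelC z y); field. Qed.

Lemma continuous_resistance x e :
  continuous (fun t : R => resistance x (epoint e t)).
Proof.
have -> : (fun t => resistance x (epoint e t)) = (fun t => green_kernel x x
    - 2 * green_kernel (epoint e t) x + green_kernel (epoint e t) (epoint e t)).
  by apply/funext => t; rewrite resistanceE (green_kernelC x (epoint e t)).
move=> t; apply: cvgD; last exact: continuous_green_kernel_diag.
by apply: cvgB; [exact: cvg_cst|apply: cvgMr; exact: continuous_green_kernel].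
Qed.

Lemma normr_green_kernel_le x y : `|green_kernel x y| <=
  (\sum_(u : vertex G) \sum_v `|discrete_kernel u v|) + \sum_(e : edge G) len e.
Proof.
have bary1 p u : `|barycentric p u| <= 1.
  rewrite ger0_norm -?(sum_barycentric p).
    rewrite (bigD1 u) //= lerDl sumr_ge0// => v _.
    exact: barycentric_ge0.
  exact: barycentric_ge0.
rewrite /green_kernel (le_trans (ler_normD _ _))// lerD//.
- rewrite (le_trans (ler_norm_sum _ _ _))// ler_sum// => u _.
  rewrite normrM (le_trans (ler_piMl _ (bary1 _ _)))//.
  rewrite (le_trans (ler_norm_sum _ _ _))// ler_sum// => v _.
  by rewrite normrM ler_piMr.
- case: x => [u|[e t]] /=.
    by rewrite normr0 sumr_ge0// => e _; rewrite ltW ?len_gt0.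
  apply: (@le_trans _ _ (len e)); last first.
    rewrite (bigD1 e) //= lerDl sumr_ge0// => e' _.
    by rewrite ltW ?len_gt0.
  exact: normr_edge_tent_le (svalP t).
Qed.

End Voltage.

(** * Integration against the canonical measure *)

Section ChargeIntegral.
Context {d : measure_display} {T : measurableType d} {R : realType}.
Variable nu : {charge set T -> \bar R}.
Implicit Types f g : T -> R.

(** Such functions are integrable against both Jordan parts of a charge, which are finite measures,
    so [charge_integral] is linear on them. *)
Definition bounded_measurable f :=
  measurable_fun setT f /\ exists M, forall x, `|f x| <= M.

Lemma bounded_measurable_integrable (mu : {finite_measure set T -> \bar R}) f :
  bounded_measurable f -> mu.-integrable setT (EFin \o f).
Proof.
case=> mf [M fM]; apply: measurable_bounded_integrable => //.
  by rewrite ltey_eq fin_num_measure.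
exists M; split; first exact: num_real.
by move=> N MN x _; rewrite /= (le_trans (fM x))// ltW.
Qed.

Lemma bounded_measurable_cst (c : R) : bounded_measurable (fun=> c).
Proof. by split; [exact: measurable_cst|exists `|c|]. Qed.

Lemma bounded_measurableZ (a : R) f : bounded_measurable f ->
  bounded_measurable (fun x => a * f x).
Proof.
case=> mf [M fM]; split.
  by apply: measurable_funM => //; exact: measurable_cst.
by exists (`|a| * M) => x; rewrite normrM ler_wpM2l.
Qed.

Lemma bounded_measurableD f g : bounded_measurable f -> bounded_measurable g ->
  bounded_measurable (fun x => f x + g x).
Proof.
case=> mf [M fM] [mg [N gN]]; split; first exact: measurable_funD.
by exists (M + N) => x; rewrite (le_trans (ler_normD _ _))// lerD.
Qed.

Lemma charge_integralZ (a : R) f : bounded_measurable f ->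
  charge_integral nu (fun x => a * f x) = a * charge_integral nu f.
Proof.
move=> bf; rewrite /charge_integral !RintegralZl//; first by rewrite mulrBr.
- exact: bounded_measurable_integrable.
- exact: bounded_measurable_integrable.
Qed.

Lemma charge_integralD f g : bounded_measurable f -> bounded_measurable g ->
  charge_integral nu (fun x => f x + g x) =
  charge_integral nu f + charge_integral nu g.
Proof.
move=> bf bg; rewrite /charge_integral !RintegralD//;
  try exact: bounded_measurable_integrable.
ring.
Qed.

Lemma charge_integral_cst (c : R) : nu setT = 1%E ->
  charge_integral nu (fun=> c) = c.
Proof.
move=> nu1; rewrite /charge_integral !Rintegral_cst// -mulrBr.
have := jordan_decomp (hahn nu) measurableT.
rewrite /cadd /= cscaleN1 nu1 => /(congr1 fine) /=.
rewrite fineD ?fineN ?fin_numN ?fin_num_measure// => <-.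
by rewrite mulr1.
Qed.

End ChargeIntegral.

(** * The Arakelov-Green function in terms of the resistance *)

Section Green.
Context {R : realType} {G : metrized_graph R}.
Implicit Types (x y z : gpoint G).

Lemma measurable_gpoint (f : gpoint G -> R) :
  (forall e : edge G, continuous (fun t : R => f (epoint e t))) ->
  measurable_fun setT (f : borel_gpoint G -> R).
Proof.
move=> fc; apply: (measurability _ (RGenOpens.measurableE R)).
move=> _ [_ [a [b ->] <-]]; rewrite setTI.
apply: sub_sigma_algebra.
have /continuousP := continuous_gpoint fc.
by apply; exact: interval_open.
Qed.

Lemma bounded_measurable_resistance x :
  bounded_measurable (resistance x : borel_gpoint G -> R).
Proof.
split; first by apply: measurable_gpoint => e; exact: continuous_resistance.
pose M : R := (\sum_(u : vertex G) \sum_v `|discrete_kernel u v|)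
  + \sum_(e : edge G) len e.
exists (4 * M) => y; rewrite resistanceE.
have := (normr_green_kernel_le x x, normr_green_kernel_le x y,
  normr_green_kernel_le y y).
rewrite -/M !ler_norml => -[[]]; lra.
Qed.

Variable mu : {charge set (borel_gpoint G) -> \bar R}.

(** Integrate [voltage_resistance] in [z]. By definition [voltage z x x] is [resistance x z], so the
    integral of [resistance x] is [voltage_mu mu x x]. *)
Lemma voltage_muE : mu setT = 1%E -> forall x y, voltage_mu mu x y =
  2^-1 * (voltage_mu mu x x + voltage_mu mu y y - resistance x y).
Proof.
move=> mu1 x y; have br z := bounded_measurable_resistance z.
have bc c := @bounded_measurable_cst _ (borel_gpoint G) R c.
have -> : voltage_mu mu x y = charge_integral mu (fun p =>
    2^-1 * resistance x p + 2^-1 * resistance y p + - (2^-1 * resistance x y)).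
  by congr charge_integral; apply/funext => p; rewrite voltage_resistance; ring.
rewrite !charge_integralD ?charge_integralZ ?charge_integral_cst//;
  try exact: bounded_measurableZ.
  by rewrite /voltage_mu -/(resistance _ _); ring.
by apply: bounded_measurableD; exact: bounded_measurableZ.
Qed.

Lemma green_resistance (mu_can : canonical_measure mu) x y :
  green mu x y = tau_constant mu - 2^-1 * resistance x y.
Proof.
have [mu1 _ [c muc]] := mu_can.
have tauE p : voltage_mu mu p p = 2 * tau_constant mu.
  (* Constancy of [voltage_mu mu x x] provides a value for the [get] in [tau_constant]. *)
  have ex : exists t, [set t : R | forall x, t = 2^-1 * voltage_mu mu x x] t.
    by exists (2^-1 * c) => q; rewrite muc.
  by have /= := getPex ex; rewrite -/(tau_constant mu) => /(_ p) ->; field.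
(* The order [resistance b a] makes the integrand in [a] literally [resistance b]. *)
have vE a b : voltage_mu mu a b = 2 * tau_constant mu + - 2^-1 * resistance b a.
  by rewrite voltage_muE// !tauE !resistanceE (green_kernelC b a); field.
rewrite /green vE.
(* For every [b] the double integral is [2 tau - (2 tau) / 2 = tau]. *)
have -> : (fun b : borel_gpoint G => charge_integral mu (fun a : borel_gpoint G =>
    charge_integral mu (fun z : borel_gpoint G => voltage z a b))) =
    (fun=> tau_constant mu).
  apply/funext => b.
  have -> : (fun a : borel_gpoint G =>
      charge_integral mu (fun z : borel_gpoint G => voltage z a b)) =
      (fun a => 2 * tau_constant mu + - 2^-1 * resistance b a).
    by apply/funext => a; exact: vE.
  have br := bounded_measurable_resistance b.
  rewrite charge_integralD ?charge_integral_cst ?charge_integralZ//.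
  - have -> : charge_integral mu (resistance b) = voltage_mu mu b b by [].
    by rewrite tauE; field.
  - exact: bounded_measurable_cst.
  - exact: bounded_measurableZ.
rewrite charge_integral_cst// !resistanceE (green_kernelC y x); ring.
Qed.

End Green.

Theorem theorem4p3 (R : realType) (G : metrized_graph R)
    (mu : {charge set (borel_gpoint G) -> \bar R})
    (mu_can : canonical_measure mu) :
  (forall (i j : edge G), ~ bridge i -> ~ bridge j -> i <> j ->
    forall x y : R, 0 <= x <= len i -> 0 <= y <= len j ->
    let p_i := vpoint (src i) in let q_i := vpoint (tgt i) in
    let p_j := vpoint (src j) in let q_j := vpoint (tgt j) in
    green mu (epoint i x) (epoint j y) =
      tau_constant mu
      + x ^+ 2 * ((len i - resistance p_i q_i) / (2 * len i ^+ 2))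
      + y ^+ 2 * ((len j - resistance p_j q_j) / (2 * len j ^+ 2))
      - (x * y) / (len i * len j) * (voltage p_j p_i q_j - voltage p_j q_i q_j)
      - x / (2 * len i) * (len i - 2 * voltage p_i q_i p_j)
      - y / (2 * len j) * (len j - 2 * voltage p_j p_i q_j)
      - 1 / 2 * resistance p_i p_j)
  /\
  (forall i : edge G, ~ bridge i ->
    forall x y : R, 0 <= x <= len i -> 0 <= y <= len i ->
    green mu (epoint i x) (epoint i y) =
      tau_constant mu - 1 / 2 * `|x - y|
      + (x - y) ^+ 2 *
        ((len i - resistance (vpoint (src i)) (vpoint (tgt i)))
         / (2 * len i ^+ 2))).

Proof.
split=> [i j _ _ ij x y xi yj /=|i _ x y xi yi]; rewrite green_resistance//.
(* As the edges are distinct, the tent of a point on one vanishes on the other. What remains is a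
   rational identity in [x], [y], the lengths and the values of [discrete_kernel] at the end
   points. *)
- have nji : (j == i) = false by apply/eqP => /esym.
  rewrite !resistanceE !voltageE !green_kernel_epoint// !green_kernel_vpoint.
  rewrite !point_kernel_vpoint !point_kernel_epoint// !edge_tent_epoint//.
  rewrite nji !eqxx !minxx.
  rewrite (discrete_kernelC (tgt i) (src i)) (discrete_kernelC (tgt j) (src j)).
  by field; rewrite !len_neq0.
- rewrite !resistanceE !green_kernel_epoint// !green_kernel_vpoint.
  rewrite !point_kernel_vpoint !point_kernel_epoint// !edge_tent_epoint//.
  rewrite !eqxx !minxx (discrete_kernelC (tgt i) (src i)).
  (* The tents contribute [x + y - 2 min(x, y)] to the resistance, which is [|x - y|]. *)
  have [xy|yx] := leP x y.
    by rewrite ler0_norm ?subr_le0//; field; rewrite len_neq0.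
  by rewrite gtr0_norm ?subr_gt0//; field; rewrite len_neq0.
Qed.
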